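(* Let $A$ be any positive semidefinite $d\times d$ matrix with spectral norm $1$, eigengap $\lambda>0$ and a (unit) leading eigenvector $\mathbf{v}_1$, and let $\mathbf{w}_0$ be any unit vector such that $\|\mathbf{w}_0-\mathbf{v}_1\|\le\frac{\lambda}{44}$. Then the function $F_A(\mathbf{w})=-\frac{\mathbf{w}^\top A\mathbf{w}}{\|\mathbf{w}\|^2}$ is $20$-smooth and $\lambda$-strongly convex on the convex set $H_{\mathbf{w}_0}\cap B_{\mathbf{w}_0}\left(\frac{\lambda}{22}\right)$, and this set contains a global optimum (minimizer over $\mathbb{R}^d\setminus\{0\}$) of $F_A$.
   Context: The eigengap is the difference $\lambda=s_1-s_2$ between the largest and second largest eigenvalues of the symmetric matrix $A$. For a unit vector $\mathbf{w}_0\in\mathbb{R}^d$ and $r>0$, $H_{\mathbf{w}_0}=\{\mathbf{w}\in\mathbb{R}^d:\langle\mathbf{w},\mathbf{w}_0\rangle=1\}$ and $B_{\mathbf{w}_0}(r)=\{\mathbf{w}\in\mathbb{R}^d:\|\mathbf{w}-\mathbf{w}_0\|\le r\}$. A twice-differentiable function is $\lambda$-strongly convex if its Hessian is always $\succ\lambda I$, and $s$-smooth if its Hessian is always $\prec sI$. On the set $H_{\mathbf{w}_0}\cap B_{\mathbf{w}_0}(r)$, which lies in a hyperplane, these properties refer to the function restricted to the hyperplane, i.e. to the quadratic form $\mathbf{g}^\top\nabla^2F_A(\mathbf{w})\mathbf{g}$ for unit directions $\mathbf{g}$ with $\langle\mathbf{g},\mathbf{w}_0\rangle=0$ at points $\mathbf{w}$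 of the set. *)

(* Defs.v *)
From mathcomp Require Export all_boot all_order all_algebra.
From mathcomp Require Export all_classical all_reals all_analysis.
Export Order.TTheory GRing.Theory Num.Theory.
Export numFieldNormedType.Exports.

Set Implicit Arguments.
Unset Strict Implicit.
Unset Printing Implicit Defensive.

Local Open Scope classical_set_scope.
Local Open Scope ring_scope.

(* Vectors of R^d are row vectors 'rV[R]_d.  The library norm `|_| on matrices
   is the sup norm (it induces the same topology, hence the same derivatives),
   so the Euclidean structure is defined separately. *)
Section Euclidean.
Context {R : realType} {d : nat}.
Implicit Types (u v w x g : 'rV[R]_d) (A : 'M[R]_d).

Definition dotp u v : R := (u *m v^T) 0 0.

Definition enorm u : R := Num.sqrt (dotp u u).

Definition qform A g : R := dotp (g *m A) g.

Definition psd_mx A : Prop := A^T = A /\ forall x, 0 <= qform A x.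

Definition spectral_norm A : R :=
  sup [set enorm (x *m A) | x in [set x | enorm x = 1]].

(* s lists the real eigenvalues of A in nonincreasing order, each repeated
   according to the dimension of its eigenspace; for symmetric A this is the
   usual list s_1 >= ... >= s_d of eigenvalues counted with multiplicity.
   Indices start at 0, so that s_1 is s`_0 and s_2 is s`_1. *)
Definition sorted_spectrum A (s : seq R) : Prop :=
  sorted (fun a b : R => b <= a) s /\
  forall a : R, count_mem a s = \rank (eigenspace A a).

Definition gradient (f : 'rV[R]_d -> R) w : 'rV[R]_d :=
  \row_i 'D_(delta_mx 0 i) f w.

Definition hessian (f : 'rV[R]_d -> R) w : 'M[R]_d := 'J (gradient f) w.

Definition twice_differentiable (f : 'rV[R]_d -> R) w : Prop :=
  (\forall x \near w, differentiable f x) /\ differentiable (gradient f) w.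

Definition hyperplane w0 : set 'rV[R]_d := [set w | dotp w w0 = 1].

Definition eball w0 (r : R) : set 'rV[R]_d := [set w | enorm (w - w0) <= r].

(* In the next two definitions C is a subset of the hyperplane <w, w0> = 1, and
   only the directions parallel to that hyperplane are considered. *)
Definition strongly_convex_on (mu : R) w0 (C : set 'rV[R]_d)
    (f : 'rV[R]_d -> R) : Prop :=
  forall w, C w -> twice_differentiable f w /\
    forall g, enorm g = 1 -> dotp g w0 = 0 -> mu < qform (hessian f w) g.

Definition smooth_on (L : R) w0 (C : set 'rV[R]_d)
    (f : 'rV[R]_d -> R) : Prop :=
  forall w, C w -> twice_differentiable f w /\
    forall g, enorm g = 1 -> dotp g w0 = 0 -> qform (hessian f w) g < L.

(* At w = 0 the value is the irrelevant 0 / 0 = 0. *)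
Definition rayleigh_loss A w : R := - qform A w / enorm w ^+ 2.

Definition global_minimizer (f : 'rV[R]_d -> R) w : Prop :=
  w != 0 /\ forall x, x != 0 -> f w <= f x.

End Euclidean.

(* Main.v *)
Require Import Defs.
From mathcomp Require Import ring lra.
Set Implicit Arguments.
Unset Strict Implicit.
Unset Printing Implicit Defensive.
Local Open Scope classical_set_scope.
Local Open Scope ring_scope.

(* With n = |w|^2, F = F_A(w), p = <w, g> and D = <wA, g> + F p, one has for a
   unit vector g
     g H g^T = (2 / n) (- F - g A g^T + (4 / n) p D),
   where H is the Hessian of F_A at w.  If <w, w0> = 1 and g is orthogonal to w0,
   then n >= 1 and |p| = |<w - w0, g>| <= lambda / 22.  Near v1, the value - F is
   at least s_1 - O(lambda^2) and D is O(lambda), while g is almost orthogonal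
   to v1, so that g A g^T is at most s_2 + O(lambda^2); the bracket is thus at
   least lambda - O(lambda^2), with constants small enough to absorb n / 2 < 1.
   The bound x A x^T <= s_2 |x|^2 on the orthogonal of v1 needs no
   diagonalization: a maximizer of the form on the unit sphere of that subspace
   exists by compactness and is an eigenvector orthogonal to v1, so its
   eigenvalue is one of s_2, s_3, ...  The minimizer in the set is
   v1 / <v1, w0>. *)

(** * Euclidean structure *)

Section EuclideanTheory.
Context {R : realType} {d : nat}.
Implicit Types (u v w x y g : 'rV[R]_d) (A : 'M[R]_d) (a m : R).

Lemma dotpE u v : dotp u v = \sum_i u 0 i * v 0 i.
Proof. by rewrite /dotp mxE; apply: eq_bigr => i _; rewrite mxE. Qed.

Lemma dotpC u v : dotp u v = dotp v u.
Proof. by rewrite !dotpE; apply: eq_bigr => i _; rewrite mulrC. Qed.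

Lemma dotpDl u v w : dotp (u + v) w = dotp u w + dotp v w.
Proof. by rewrite /dotp mulmxDl mxE. Qed.

Lemma dotpZl a u v : dotp (a *: u) v = a * dotp u v.
Proof. by rewrite /dotp -scalemxAl mxE. Qed.

Lemma dotpNl u v : dotp (- u) v = - dotp u v.
Proof. by rewrite -scaleN1r dotpZl mulN1r. Qed.

Lemma dotpBl u v w : dotp (u - v) w = dotp u w - dotp v w.
Proof. by rewrite dotpDl dotpNl. Qed.

Lemma dotpDr u v w : dotp u (v + w) = dotp u v + dotp u w.
Proof. by rewrite dotpC dotpDl !(dotpC u). Qed.

Lemma dotpZr a u v : dotp u (a *: v) = a * dotp u v.
Proof. by rewrite dotpC dotpZl dotpC. Qed.

Lemma dotpBr u v w : dotp u (v - w) = dotp u v - dotp u w.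
Proof. by rewrite dotpC dotpBl !(dotpC u). Qed.

Lemma dotp_ge0 u : 0 <= dotp u u.
Proof. by rewrite dotpE sumr_ge0 // => i _; rewrite -expr2 sqr_ge0. Qed.

Lemma dotp_eq0 u : (dotp u u == 0) = (u == 0).
Proof.
apply/idP/eqP => [|->]; last by rewrite /dotp mul0mx mxE.
rewrite dotpE psumr_eq0 => [/allP u0|i _]; last by rewrite -expr2 sqr_ge0.
apply/rowP => i; have /eqP := u0 i (mem_index_enum i).
by rewrite mxE => /eqP; rewrite mulf_eq0 orbb => /eqP.
Qed.

Lemma dotp_gt0 u : u != 0 -> 0 < dotp u u.
Proof. by move=> u0; rewrite lt_def dotp_eq0 u0 dotp_ge0. Qed.

Lemma dotp_mulmx_sym A u v : A^T = A -> dotp (u *m A) v = dotp u (v *m A).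
Proof. by move=> sA; rewrite /dotp trmx_mul sA mulmxA. Qed.

(** The square of [dotp v v *: u - dotp u v *: v] is [dotp v v] times the difference of the two
    sides. *)
Lemma cauchy_schwarz u v : dotp u v ^+ 2 <= dotp u u * dotp v v.
Proof.
have [->|v0] := eqVneq v 0.
  by rewrite dotpC /dotp !mul0mx mxE expr0n mulr0.
have := dotp_ge0 (dotp v v *: u - dotp u v *: v).
rewrite dotpBl !dotpBr !dotpZl !dotpZr (dotpC v u) => h.
rewrite -subr_ge0 -(pmulr_rge0 _ (dotp_gt0 v0)).
by move: h; congr (_ <= _); ring.
Qed.

Lemma enorm_ge0 u : 0 <= enorm u.
Proof. exact: sqrtr_ge0. Qed.

Lemma sqr_enorm u : enorm u ^+ 2 = dotp u u.
Proof. by rewrite sqr_sqrtr ?dotp_ge0. Qed.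

Lemma enorm_eq1 u : (enorm u = 1) <-> (dotp u u = 1).
Proof.
split=> [u1|]; first by rewrite -sqr_enorm u1 expr1n.
by rewrite /enorm => ->; rewrite sqrtr1.
Qed.

Lemma enorm_le a u : 0 <= a -> (enorm u <= a) = (dotp u u <= a ^+ 2).
Proof. by move=> a0; rewrite -sqr_enorm ler_sqr ?nnegrE ?enorm_ge0. Qed.

Lemma normr_dotp a b u v : 0 <= a -> 0 <= b ->
  dotp u u <= a ^+ 2 -> dotp v v <= b ^+ 2 -> `|dotp u v| <= a * b.
Proof.
move=> a0 b0 ua vb; rewrite -ler_sqr ?nnegrE ?mulr_ge0 // real_normK ?num_real //.
by rewrite (le_trans (cauchy_schwarz _ _)) // exprMn ler_pM ?dotp_ge0.
Qed.

(** * Quadratic forms and matrices of spectral norm 1 *)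

Lemma qformZ A a u : qform A (a *: u) = a ^+ 2 * qform A u.
Proof. by rewrite /qform -scalemxAl dotpZl dotpZr mulrA. Qed.

Lemma qform_le1 A x : (forall y, dotp (y *m A) (y *m A) <= dotp y y) ->
  qform A x <= dotp x x.
Proof.
move=> h; have := @normr_dotp (enorm x) (enorm x) (x *m A) x.
rewrite sqr_enorm enorm_ge0 h lexx => /(_ erefl erefl erefl erefl).
by rewrite -expr2 sqr_enorm => /(le_trans (ler_norm _)).
Qed.

Lemma spectral_norm1_contract A x : spectral_norm A = 1 ->
  dotp (x *m A) (x *m A) <= dotp x x.
Proof.
have [->|x0] := eqVneq x 0; first by rewrite mul0mx.
rewrite /spectral_norm; set S := (X in sup X) => S1.
(* A set without supremum has [sup] equal to 0, so the value 1 forces [S] to be bounded above. *)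
have Ssup : has_sup S.
  apply: contrapT => nS; move: S1.
  by rewrite sup_out // => /eqP; rewrite eq_sym oner_eq0.
have e0 : 0 < enorm x by rewrite sqrtr_gt0 dotp_gt0.
have : enorm ((enorm x)^-1 *: x *m A) <= 1.
  rewrite -S1; apply: ub_le_sup; first by case: Ssup.
  exists ((enorm x)^-1 *: x) => //=; apply/enorm_eq1.
  by rewrite dotpZl dotpZr -sqr_enorm expr2 mulKf ?mulVf ?gt_eqF.
rewrite enorm_le // -scalemxAl dotpZl dotpZr expr1n mulrA -expr2 exprVn.
by rewrite mulrC ler_pdivrMr ?exprn_gt0 // mul1r sqr_enorm.
Qed.

(** By symmetry the cross term is [s1] times the product of [v] with a vector orthogonal to it,
    hence 0. *)
Lemma qform_split A (s1 : R) v x : A^T = A -> v *m A = s1 *: v -> dotp v v = 1 ->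
  qform A x = s1 * dotp x v ^+ 2 + qform A (x - dotp x v *: v).
Proof.
move=> sA vA v1; have xAv : dotp (x *m A) v = s1 * dotp x v.
  by rewrite dotp_mulmx_sym // vA dotpZr.
rewrite /qform mulmxBl -scalemxAl vA.
rewrite !dotpBl !dotpBr !dotpZl !dotpZr v1 xAv (dotpC v x); ring.
Qed.

End EuclideanTheory.

(** * Gradient and Hessian of the Rayleigh loss *)

(** The increment of [h] vanishes near [x], so it is little-o of the identity; uniqueness of the
    differential then gives the zero map. *)
Lemma near0_differentiable (R : realType) (V W : normedModType R) (h : V -> W)
    (x : V) :
  (\near x, h x = 0) -> differentiable h x.
Proof.
move=> h0; have hx : h \o shift x = cst (h x) + (0 : V -> W) +o_ 0 id.
  apply/eqaddoP => e e0.
  have h0' : \forall y \near 0, h (y + x) = 0.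
    by move: h0; rewrite (near_shift 0 x) subr0.
  have hx0 := nbhs_singleton h0.
  near=> y.
  have -> : (h \o shift x - (cst (h x) + (0 : V -> W))) y = 0.
    rewrite !fctE /= hx0 /= !addr0 subr0.
    by near: y; exact: h0'.
  by rewrite normr0 mulr_ge0 // ltW.
have c0 : continuous (0 : V -> W) by exact: cst_continuous.
have /= D := @diff_unique R V W h \0 x c0 hx.
by apply/diff_locallyP; rewrite D.
Unshelve. all: by end_near. Qed.

(** Serves to replace the gradient by its closed form, which is established only away from 0. *)
Lemma near_eq_differentiable (R : realType) (V W : normedModType R)
    (f g : V -> W) (x : V) :
  (\near x, f x = g x) -> differentiable f x -> differentiable g x.
Proof.
move=> fg df; have -> : g = f + (g - f).
  by apply/funext => y; rewrite !fctE /= addrC subrK.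
apply: differentiableD; first exact: df.
apply: near0_differentiable; near=> y.
rewrite !fctE /=; apply/eqP; rewrite subr_eq0 eq_sym; apply/eqP.
by near: y; exact: fg.
Unshelve. all: by end_near. Qed.

Section Derivatives.
Context {R : realType} {d : nat}.
Implicit Types (u v w x y g : 'rV[R]_d) (A : 'M[R]_d) (a m : R).

Lemma is_derive_coord x v i : is_derive x v (fun y : 'rV[R]_d => y 0 i : R) (v 0 i).
Proof.
have dx := @diff_derivable _ _ _ _ x v (differentiable_coord x 0 i).
apply: DeriveDef => //.
have := derive_mx (@derivable_id R 'rV[R]_d x v).
by rewrite derive_id => /rowP/(_ i); rewrite mxE.
Qed.

Lemma differentiable_dotpl x u : differentiable (fun y => dotp y u : R) x.
Proof.
rewrite (_ : (fun _ => _) = \sum_i (fun y : 'rV[R]_d => y 0 i * u 0 i)).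
  apply: differentiable_sum => i; apply: differentiableM => //.
  exact: differentiable_coord.
by apply/funext => y; rewrite dotpE fct_sumE.
Qed.

Lemma is_derive_dotpl x v u : is_derive x v (fun y => dotp y u : R) (dotp v u).
Proof.
rewrite (_ : (fun _ => _) = \sum_i u 0 i *: (fun y : 'rV[R]_d => y 0 i : R)).
  rewrite dotpE; apply: is_derive_eq.
    by apply: is_derive_sum => i; apply: is_deriveZ; exact: is_derive_coord.
  by apply: eq_bigr => i _; rewrite mulrC.
by apply/funext => y; rewrite dotpE fct_sumE; apply: eq_bigr => i _; rewrite mulrC.
Qed.

Lemma mulmx_coord A x i : (x *m A) 0 i = dotp x (row i A^T).
Proof. by rewrite dotpE mxE; apply: eq_bigr => j _; rewrite !mxE. Qed.

Lemma qformE A : qform A =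
  \sum_i (fun y => dotp y (row i A^T)) * (fun y : 'rV[R]_d => y 0 i : R).
Proof.
apply/funext => y; rewrite fct_sumE /qform dotpE.
by apply: eq_bigr => i _; rewrite mulmx_coord.
Qed.

Lemma differentiable_qform A x : differentiable (qform A : _ -> R) x.
Proof.
rewrite qformE; apply: differentiable_sum => i; apply: differentiableM.
  exact: differentiable_dotpl.
exact: differentiable_coord.
Qed.

Lemma is_derive_qform A x v : A^T = A ->
  is_derive x v (qform A : _ -> R) (2 * dotp (x *m A) v).
Proof.
move=> sA; rewrite qformE; apply: is_derive_eq.
  apply: is_derive_sum => i; apply: is_deriveM.
    exact: is_derive_dotpl.
  exact: is_derive_coord.
rewrite /= big_split /= /GRing.scale /=.
under eq_bigr do rewrite -mulmx_coord.
under [X in _ + X]eq_bigr do rewrite -mulmx_coord mulrC.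
by rewrite -!dotpE [dotp (v *m A) x]dotpC -dotp_mulmx_sym // mulr_natl mulr2n.
Qed.

(* Lets |x|^2 and x A x^T share the same differentiation lemmas. *)
Lemma dotp_qform x : dotp x x = qform 1%:M x.
Proof. by rewrite /qform mulmx1. Qed.

Lemma rayleigh_lossE A : rayleigh_loss A =
  (fun x => - (qform A x * (qform 1%:M x)^-1)) :> ('rV[R]_d -> R).
Proof. by apply/funext => x; rewrite /rayleigh_loss sqr_enorm dotp_qform mulNr. Qed.

Lemma differentiable_rayleigh_loss A x : x != 0 ->
  differentiable (rayleigh_loss A : 'rV[R]_d -> R) x.
Proof.
move=> x0; rewrite rayleigh_lossE; apply: differentiableN.
apply: differentiableM; first exact: differentiable_qform.
apply: differentiableV; first exact: differentiable_qform.
by rewrite -dotp_qform dotp_eq0.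
Qed.

Lemma is_derive_inv_dotp x v : x != 0 ->
  is_derive x v (fun y => (qform 1%:M y)^-1 : R) (- 2 * dotp x v / dotp x x ^+ 2).
Proof.
move=> x0; have n0 : qform 1%:M x != 0 by rewrite -dotp_qform dotp_eq0.
have [dq Dq] := is_derive_qform x v (trmx1 R d).
apply: DeriveDef; first exact: derivableV.
rewrite deriveV // Dq mulmx1 -dotp_qform /GRing.scale /=; ring.
Qed.

(** Quotient rule, regrouped so that the loss itself reappears; the result can then be
    differentiated again by the product rule. *)
Lemma is_derive_rayleigh_loss A x v : A^T = A -> x != 0 ->
  is_derive x v (rayleigh_loss A : _ -> R)
    (- 2 / dotp x x * (dotp (x *m A) v + rayleigh_loss A x * dotp x v)).
Proof.
move=> sA x0; have n0 : dotp x x != 0 by rewrite dotp_eq0.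
rewrite {1}rayleigh_lossE; apply: is_derive_eq.
  apply: is_deriveN; apply: is_deriveM.
    exact: is_derive_qform.
  exact: is_derive_inv_dotp.
rewrite rayleigh_lossE -dotp_qform /GRing.scale /=; field.
by [].
Qed.

Lemma dotp_delta x i : dotp x (delta_mx 0 i) = x 0 i.
Proof. by rewrite /dotp trmx_delta -colE mxE. Qed.

Lemma gradient_rayleigh_loss A x : A^T = A -> x != 0 ->
  gradient (rayleigh_loss A) x =
    \row_i (- 2 * (qform 1%:M x)^-1 *
            (dotp x (row i A^T) + rayleigh_loss A x * x 0 i)).
Proof.
move=> sA x0; apply/rowP => i; rewrite !mxE.
have [_ ->] := is_derive_rayleigh_loss (delta_mx 0 i) sA x0.
by rewrite !dotp_delta mulmx_coord dotp_qform.
Qed.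

Lemma differentiable_row n (f : 'I_n -> 'rV[R]_d -> R) x :
  (forall i, differentiable (f i) x) ->
  differentiable (fun y => \row_i f i y) x.
Proof.
move=> df; rewrite (_ : (fun _ => _) =
    \sum_i (fun y => f i y *: (delta_mx 0 i : 'rV[R]_n))).
  by apply: differentiable_sum => i; exact: differentiableZl.
apply/funext => y; rewrite fct_sumE [LHS]row_sum_delta.
by apply: eq_bigr => i _; rewrite mxE.
Qed.

(** Closed form of the [i]-th partial derivative of the loss at a nonzero point, for symmetric
    [A]. *)
Definition loss_gradient_coord A i y :=
  - 2 * (qform 1%:M y)^-1 * (dotp y (row i A^T) + rayleigh_loss A y * y 0 i).

Lemma near_neq0 x : x != 0 -> \forall y \near x, y != 0.
Proof.
move=> x0; have n0 : 0 < dotp x x by exact: dotp_gt0.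
have cn : {for x, continuous (qform 1%:M : 'rV[R]_d -> R)}.
  by apply/differentiable_continuous/differentiable_qform.
have : \forall y \near x, 0 < qform 1%:M y.
  by apply: (cvgr_gt _ cn); rewrite -dotp_qform.
apply: filterS => y; rewrite -dotp_qform; apply: contraTneq => ->.
by rewrite (eqP (etrans (dotp_eq0 0) (eqxx 0))) ltxx.
Qed.

Lemma twice_differentiable_rayleigh_loss A x : A^T = A -> x != 0 ->
  twice_differentiable (rayleigh_loss A) x.
Proof.
move=> sA x0; split.
  apply: filterS (near_neq0 x0) => y; exact: differentiable_rayleigh_loss.
apply: (@near_eq_differentiable _ _ _ (fun y => \row_i loss_gradient_coord A i y)).
  by apply: filterS (near_neq0 x0) => y y0; rewrite gradient_rayleigh_loss.
apply: differentiable_row => i; apply: differentiableM.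
  apply: differentiableM; first exact: differentiable_cst.
  apply: differentiableV; first exact: differentiable_qform.
  by rewrite -dotp_qform dotp_eq0.
apply: differentiableD; first exact: differentiable_dotpl.
apply: differentiableM; first exact: differentiable_rayleigh_loss.
exact: differentiable_coord.
Qed.

Lemma qform_hessian A x g : A^T = A -> x != 0 -> let F := rayleigh_loss A x in
  qform (hessian (rayleigh_loss A) x) g = - 2 / dotp x x *
    (qform A g + F * dotp g g
     - 4 / dotp x x * dotp x g * (dotp (x *m A) g + F * dotp x g)).
Proof.
move=> sA x0 F; have n0 : dotp x x != 0 by rewrite dotp_eq0.
have [_ dG] := twice_differentiable_rayleigh_loss sA x0.
(* The Jacobian applied to [g] is the derivative of the gradient along [g], so a single directional
   derivative suffices. *)
rewrite {1}/qform /hessian -deriveEjacobian //.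
have -> : 'D_g (gradient (rayleigh_loss A)) x =
    \row_i 'D_g (loss_gradient_coord A i) x.
  rewrite derive_mx; last exact: diff_derivable.
  apply/rowP => i; rewrite !mxE; apply: near_eq_derive.
  by apply: filterS (near_neq0 x0) => y y0; rewrite gradient_rayleigh_loss // mxE.
(* The derivative of the loss along [g] is [- 2 / dotp x x * c]. Below, the first summand of [D]
   comes from the inverse squared norm, the second from the bracket. *)
pose c := dotp (x *m A) g + F * dotp x g.
have D i : 'D_g (loss_gradient_coord A i) x =
   4 * dotp x g / dotp x x ^+ 2 * ((x *m A) 0 i + F * x 0 i)
   - 2 / dotp x x * ((g *m A) 0 i + F * g 0 i - 2 / dotp x x * c * x 0 i).
  have dn := is_derive_inv_dotp g x0.
  have dF := is_derive_rayleigh_loss g sA x0.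
  have dL := is_deriveM (is_derive_cst (- 2 : R) x g) dn.
  have dR := is_deriveD (is_derive_dotpl x g (row i A^T))
                        (is_deriveM dF (is_derive_coord x g i)).
  have [_ dG'] := is_deriveM dL dR.
  rewrite [LHS]dG' !fctE /= -!mulmx_coord -dotp_qform -/F /GRing.scale /= -/c.
  field.
  by [].
have -> : \row_i 'D_g (loss_gradient_coord A i) x =
    (4 * dotp x g / dotp x x ^+ 2) *: (x *m A + F *: x)
    - (2 / dotp x x) *: (g *m A + F *: g - (2 / dotp x x * c) *: x).
  by apply/rowP => i; rewrite !mxE D !mxE.
rewrite !(dotpBl, dotpZl, dotpDl) -/c -/(qform A g); field.
by [].
Qed.

End Derivatives.

(** * The quadratic form on the orthogonal of the leading eigenvector *)

Section Variational.
Context {R : realType} {d : nat}.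
Implicit Types (u v w x y g : 'rV[R]_d) (A : 'M[R]_d) (a m : R).

Lemma compact_sphere_orth v :
  compact [set x : 'rV[R]_d | dotp x x = 1 /\ dotp x v = 0].
Proof.
apply: bounded_closed_compact.
  exists 1; split => [//|M M1 x [x1 _]].
  rewrite /Num.Def.normr /= mx_normrE (bigmax_le _ (ltW (lt_trans ltr01 M1))) //.
  move=> [i j] _ /=; rewrite ord1; apply/ltW/(le_lt_trans _ M1).
  (* The square of one coordinate is a summand of [dotp x x], which is 1. *)
  rewrite -(@expr_le1 _ 2) // real_normK ?num_real // -x1 dotpE.
  rewrite (bigD1 j) //= expr2 lerDl sumr_ge0 //.
  by move=> k _; rewrite -expr2 sqr_ge0.
have -> : [set x : 'rV[R]_d | dotp x x = 1 /\ dotp x v = 0] =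
    (qform 1%:M @^-1` [set 1]) `&` ((fun x => dotp x v) @^-1` [set 0]).
  by apply/seteqP; split => x /=; rewrite dotp_qform.
apply: closedI; apply: closed_comp; try exact: closed_eq.
  by move=> x _; apply/differentiable_continuous/differentiable_qform.
by move=> x _; apply/differentiable_continuous/differentiable_dotpl.
Qed.

Lemma quadratic_ge0_lin0 (b c : R) :
  (forall t : R, 0 <= t * b + t ^+ 2 * c) -> b = 0.
Proof.
move=> h; apply/eqP; rewrite -sqrf_eq0 eq_le sqr_ge0 andbT.
have c1 : 0 < `|c| + 1 by rewrite ltr_wpDl.
(* The 1 added to [|c|] keeps the denominator positive and makes the last factor, [c - (|c| + 1)],
   negative. *)
have := h (- b / (`|c| + 1)).
have -> : - b / (`|c| + 1) * b + (- b / (`|c| + 1)) ^+ 2 * c =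
  b ^+ 2 / (`|c| + 1) ^+ 2 * (c - (`|c| + 1)) by field; rewrite gt_eqF.
have := ler_norm c => cc.
have [->|b0] := eqVneq b 0; first by rewrite expr0n.
rewrite pmulr_rge0; last by rewrite divr_gt0 ?exprn_even_gt0 ?(gt_eqF c1).
by move=> h1; exfalso; lra.
Qed.

(** First-order optimality: [u] maximizes the form on the unit sphere orthogonal to [v], which is
    nonempty thanks to [x], and the residual [z] of the eigenvector equation is an admissible
    direction. *)
Lemma ex_max_eigenvector_orth A v (s1 : R) x : A^T = A -> v *m A = s1 *: v ->
  x != 0 -> dotp x v = 0 ->
  exists2 m, (exists2 u, dotp u u = 1 /\ dotp u v = 0 & u *m A = m *: u) &
    forall y, dotp y v = 0 -> qform A y <= m * dotp y y.
Proof.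
move=> sA vA x0 xv; pose S := [set x : 'rV[R]_d | dotp x x = 1 /\ dotp x v = 0].
have unit_in y : y != 0 -> dotp y v = 0 -> S ((enorm y)^-1 *: y).
  move=> y0 yv; split; last by rewrite dotpZl yv mulr0.
  have e0 : 0 < enorm y by rewrite sqrtr_gt0 dotp_gt0.
  by rewrite dotpZl dotpZr -sqr_enorm expr2 mulKf ?mulVf ?gt_eqF.
have [|||u] := @EVT_max_rV R d (qform A) S.
- by exists ((enorm x)^-1 *: x); exact: unit_in.
- exact: compact_sphere_orth.
- apply: continuous_subspaceT => y.
  by apply/differentiable_continuous/differentiable_qform.
rewrite inE => -[u1 uv] umax; set m := qform A u in umax.
have le_m y : dotp y v = 0 -> qform A y <= m * dotp y y.
  have [->|y0] := eqVneq y 0.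
    by rewrite /qform mul0mx /dotp !mul0mx mxE mulr0.
  move=> yv; have := umax _ (mem_set (unit_in _ y0 yv)).
  rewrite qformZ exprVn sqr_enorm mulrC ler_pdivrMr //; exact: dotp_gt0.
exists m => //; exists u => //.
have [z zE] : exists z, z = m *: u - u *m A by exists (m *: u - u *m A).
have zv : dotp z v = 0.
  by rewrite zE dotpBl dotpZl dotp_mulmx_sym // vA dotpZr uv !mulr0 subr0.
have zz : 2 * dotp z z = 0.
  (* At [u + t *: z] the nonnegative quantity [m * dotp y y - qform A y] has no constant term, and
     its linear coefficient is [2 * dotp z z]. *)
  apply: (@quadratic_ge0_lin0 _ (m * dotp z z - qform A z)) => t.
  have tv : dotp (u + t *: z) v = 0 by rewrite dotpDl dotpZl uv zv mulr0 addr0.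
  have := le_m _ tv; rewrite -subr_ge0; congr (_ <= _).
  have -> : dotp z z = m * dotp u z - dotp (u *m A) z.
    by rewrite {1}zE dotpBl dotpZl.
  rewrite /qform mulmxDl -scalemxAl !(dotpDl, dotpDr, dotpZl, dotpZr) u1.
  rewrite -/(qform A u) -/m -/(qform A z).
  rewrite (dotpC z u) (dotpC (z *m A) u) -(dotp_mulmx_sym _ _ sA).
  have -> : dotp z z = m * dotp u z - dotp (u *m A) z.
    by rewrite {1}zE dotpBl dotpZl.
  ring.
apply/eqP; rewrite -subr_eq0 -opprB -zE oppr_eq0 -dotp_eq0; apply/eqP; lra.
Qed.

Lemma eigenvector_mem_spectrum A s (s1 : R) v : sorted_spectrum A s ->
  v != 0 -> v *m A = s1 *: v -> s1 \in s.
Proof.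
move=> [_ cnt] v0 vA; rewrite -has_pred1 has_count cnt lt0n mxrank_eq0.
apply: contraNneq v0 => E0; move/eigenspaceP: vA.
by rewrite E0 submx0.
Qed.

(** The Gram matrix of the orthonormal pair is the identity of size 2, so the pair spans a plane
    inside the eigenspace. *)
Lemma mxrank_eigenspace_gt1 A (s1 : R) v u :
  v *m A = s1 *: v -> u *m A = s1 *: u ->
  dotp v v = 1 -> dotp u u = 1 -> dotp u v = 0 -> (1 < \rank (eigenspace A s1))%N.
Proof.
move=> /eigenspaceP vE /eigenspaceP uE v1 u1 uv.
have dotp_mx x y : x *m y^T = (dotp x y)%:M by exact: mx11_scalar.
have : (col_mx v u <= eigenspace A s1)%MS by rewrite col_mx_sub vE uE.
move/mxrankS; apply: leq_trans.
apply: leq_trans (mxrankM_maxl _ (col_mx v u)^T).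
rewrite tr_col_mx mul_col_row !dotp_mx v1 u1 (dotpC v u) uv.
by rewrite raddf0 -scalar_mx_block mxrank1.
Qed.

(** Either [m] lies in the tail of [s], where the order bounds it by the head of the tail, or it
    equals the first entry; then multiplicity at least 2 leaves another copy in the tail. *)
Lemma le_nth1_spectrum A s v u (m : R) : sorted_spectrum A s ->
  v *m A = s`_0 *: v -> dotp v v = 1 ->
  u *m A = m *: u -> dotp u u = 1 -> dotp u v = 0 -> m <= s`_1.
Proof.
move=> sp vA v1 uA u1 uv; have u0 : u != 0 by rewrite -dotp_eq0 u1 oner_eq0.
have := eigenvector_mem_spectrum sp u0 uA; have [srt cnt] := sp.
case: s srt cnt vA {sp} => // x s /= srt cnt vA; rewrite inE => ms.
suff ms' : m \in s.
  case: s ms' srt {cnt ms} => //= y s /predU1P[-> //|ms] /andP[_] srt.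
  have tr : transitive (fun a b : R => b <= a).
    by move=> b a c ba cb; exact: le_trans cb ba.
  exact: allP (order_path_min tr srt) m ms.
case/predU1P: ms => // mx; rewrite mx in uA *.
have := mxrank_eigenspace_gt1 vA uA v1 u1 uv.
by rewrite -cnt /= eqxx ltnS -has_count has_pred1.
Qed.

Lemma qform_le_nth1 A s v x : A^T = A -> sorted_spectrum A s ->
  v *m A = s`_0 *: v -> dotp v v = 1 -> dotp x v = 0 ->
  qform A x <= s`_1 * dotp x x.
Proof.
move=> sA sp vA v1 xv; have [->|x0] := eqVneq x 0.
  by rewrite /qform mul0mx /dotp !mul0mx mxE mulr0.
have [m [u [u1 uv] uA] le_m] := ex_max_eigenvector_orth sA vA x0 xv.
rewrite (le_trans (le_m _ xv)) // ler_wpM2r ?dotp_ge0 //.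
exact: (le_nth1_spectrum sp vA v1 uA u1 uv).
Qed.

End Variational.

(** * Estimates near the leading eigenvector *)

Section Estimates.
Context {R : realType} {d : nat}.
Implicit Types (u v w x y g : 'rV[R]_d) (A : 'M[R]_d) (a m : R).

Lemma dotpD_le (a b : R) u v : 0 <= a -> 0 <= b ->
  dotp u u <= a ^+ 2 -> dotp v v <= b ^+ 2 -> dotp (u + v) (u + v) <= (a + b) ^+ 2.
Proof.
move=> a0 b0 ua vb; have := normr_dotp a0 b0 ua vb.
rewrite ler_norml => /andP[_ uv].
rewrite dotpDl !dotpDr (dotpC v u) sqrrD; lra.
Qed.

Lemma convex_hyperplane_eball w0 (r : R) : 0 <= r ->
  @convex_set R 'rV[R]_d (hyperplane w0 `&` eball w0 r).
Proof.
move=> r0 x y t; rewrite !inE => -[x1 xr] [y1 yr].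
have t0 : 0 <= t%:num by [].
have t1 : 0 <= 1 - t%:num by rewrite subr_ge0.
pose z : 'rV[R]_d := t%:num *: (x : 'rV[R]_d) + (1 - t%:num) *: (y : 'rV[R]_d).
suff : (hyperplane w0 `&` eball w0 r) z by [].
split; first by rewrite /hyperplane /= dotpDl !dotpZl x1 y1; ring.
rewrite /eball /=; have -> : z - w0 =
    t%:num *: ((x : 'rV[R]_d) - w0) + (1 - t%:num) *: ((y : 'rV[R]_d) - w0).
  by apply/rowP => i; rewrite !mxE; ring.
move: xr yr; rewrite /eball /= !enorm_le // => xr yr.
have -> : r ^+ 2 = (t%:num * r + (1 - t%:num) * r) ^+ 2 by ring.
by apply: dotpD_le; rewrite ?mulr_ge0 // dotpZl dotpZr mulrA -expr2 exprMn
  ler_wpM2l ?sqr_ge0.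
Qed.

(** Pythagoras: [w - w0] is orthogonal to [w0]. *)
Lemma hyperplane_dotp w0 w : dotp w0 w0 = 1 -> dotp w w0 = 1 ->
  dotp w w = 1 + dotp (w - w0) (w - w0).
Proof. by move=> w01 ww0; rewrite dotpBl !dotpBr (dotpC w0 w) w01 ww0; ring. Qed.

Lemma rayleigh_loss_bounds A w : psd_mx A -> spectral_norm A = 1 ->
  w != 0 -> -1 <= rayleigh_loss A w <= 0.
Proof.
move=> [_ pA] nA w0; rewrite /rayleigh_loss sqr_enorm.
rewrite ler_pdivlMr ?ler_pdivrMr ?dotp_gt0 // mul0r oppr_le0 pA mulN1r lerN2.
by rewrite andbT qform_le1 // => y; exact: spectral_norm1_contract.
Qed.

Lemma nth1_spectrum_ge0 A s : psd_mx A -> sorted_spectrum A s -> 0 <= s`_1.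
Proof.
move=> [_ pA] [_ cnt]; have [s2|s2] := ltnP 1 (size s); last by rewrite nth_default.
have : eigenspace A s`_1 != 0.
  by rewrite -mxrank_eq0 -cnt -lt0n -has_count has_pred1 mem_nth.
move=> /eigenvalueP[x xA x0]; have := pA x.
by rewrite /qform xA dotpZl pmulr_lge0 // dotp_gt0.
Qed.

(** Bounds the correction term of the Hessian; the factor [n] allowed in the bound on [D] cancels
    the division by [n]. *)
Lemma cross_term_le (n p D b c : R) : 0 < n -> 0 <= b ->
  `|p| <= b -> `|D| <= c * n -> `|4 / n * p * D| <= 4 * b * c.
Proof.
move=> n0 b0 pb Dc; have := ler_pM (normr_ge0 _) (normr_ge0 _) pb Dc.
rewrite -normrM => pD; rewrite -mulrA normrM ger0_norm ?divr_ge0 ?(ltW n0) //.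
rewrite [leLHS]mulrAC ler_pdivrMr //; lra.
Qed.

Lemma rayleigh_hessian_bounds A s (lambda : R) v1 w0 w g :
  psd_mx A -> spectral_norm A = 1 -> sorted_spectrum A s ->
  lambda = s`_0 - s`_1 -> 0 < lambda ->
  dotp v1 v1 = 1 -> v1 *m A = s`_0 *: v1 -> dotp w0 w0 = 1 ->
  dotp (w0 - v1) (w0 - v1) <= (lambda / 44) ^+ 2 ->
  dotp w w0 = 1 -> dotp (w - w0) (w - w0) <= (lambda / 22) ^+ 2 ->
  dotp g g = 1 -> dotp g w0 = 0 ->
  lambda < qform (hessian (rayleigh_loss A) w) g < 20.
Proof.
move=> psdA nA sp lE l0 v11 v1A w01 w0v1 ww0 wr g1 gw0.
have [sA pA] := psdA.
have wA1 x : dotp (x *m A) (x *m A) <= dotp x x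
  by exact: spectral_norm1_contract.
have s1le : s`_0 <= 1.
  by have := qform_le1 v1 wA1; rewrite /qform v1A dotpZl v11 mulr1.
have s2ge := nth1_spectrum_ge0 psdA sp.
have l1 : lambda <= 1 by lra.
have nE := hyperplane_dotp w01 ww0.
have n1 : 1 <= dotp w w by rewrite nE lerDl dotp_ge0.
have wn0 : w != 0 by rewrite -dotp_eq0; apply/eqP => n0; move: n1; rewrite n0; lra.
have := rayleigh_loss_bounds psdA nA wn0.
rewrite qform_hessian // g1 mulr1.
have FE : rayleigh_loss A w * dotp w w = - qform A w.
  by rewrite /rayleigh_loss sqr_enorm divfK // dotp_eq0.
set F := rayleigh_loss A w in FE *; set n := dotp w w in nE n1 FE *.
have n0 : 0 < n by lra.
move=> /andP[F1 F0].
set p := dotp w g; set t := dotp (w *m A) g; set Q := qform A g.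
have pE : p = dotp (w - w0) g by rewrite dotpBl (dotpC w0) gw0 subr0.
have l22 : 0 <= lambda / 22 by lra.
have l44 : 0 <= lambda / 44 by lra.
have g1' : dotp g g <= 1 ^+ 2 by rewrite g1 expr1n.
have pb : `|p| <= lambda / 22.
  by rewrite pE -[leRHS]mulr1 normr_dotp.
have nle : n <= 1 + (lambda / 22) ^+ 2 by rewrite nE lerD2l.
have Q0 : 0 <= Q by exact: pA.
set b := dotp w v1; set a := dotp g v1.
have ab : `|a| <= lambda / 44.
  have -> : a = - dotp (w0 - v1) g.
    by rewrite dotpBl (dotpC w0) gw0 (dotpC v1) sub0r opprK.
  by rewrite normrN -[leRHS]mulr1 normr_dotp.
have nn : n <= n ^+ 2 by rewrite expr2 ler_pMr.
have bb : `|b| <= n.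
  by rewrite -[leRHS]mulr1 normr_dotp ?v11 ?expr1n // ltW.
pose w' := w - b *: v1.
(* The multiple of [v1] closest to [w] is [b *: v1], so [w'] is no longer than [w - v1], whose norm
   is at most lambda/22 + lambda/44. *)
have w'b : dotp w' w' <= (3 * lambda / 44) ^+ 2.
  apply: (@le_trans _ _ (dotp (w - v1) (w - v1))).
    rewrite -subr_ge0 !(dotpBl, dotpBr, dotpZl, dotpZr) v11 (dotpC v1 w) -/b.
    by have := sqr_ge0 (b - 1); congr (_ <= _); ring.
  rewrite (_ : w - v1 = (w - w0) + (w0 - v1)); last by rewrite addrA subrK.
  rewrite (le_trans (dotpD_le l22 l44 wr w0v1)) //.
  by rewrite (_ : lambda / 22 + _ = 3 * lambda / 44) //; field.
have d0 : 0 <= 3 * lambda / 44 by lra.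
have w'g : `|dotp w' g| <= 3 * lambda / 44 by rewrite -[leRHS]mulr1 normr_dotp.
have w'Ag : `|dotp (w' *m A) g| <= 3 * lambda / 44.
  by rewrite -[leRHS]mulr1 normr_dotp // (le_trans (wA1 _)).
have DE : t + F * p = b * (s`_0 + F) * a + dotp (w' *m A) g + F * dotp w' g.
  rewrite /w' mulmxBl -scalemxAl v1A !dotpBl !dotpZl -/t -/p (dotpC v1) -/a; ring.
(* The three terms of [DE] contribute 1, 3 and 3 times lambda/44; only the first carries a factor
   [n], and [1 <= n] absorbs the others. *)
have Db : `|t + F * p| <= 7 * lambda / 44 * n.
  have sF : `|s`_0 + F| <= 1 by rewrite ler_norml; apply/andP; split; lra.
  have baF : `|b * (s`_0 + F) * a| <= n * 1 * (lambda / 44).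
    by rewrite !normrM !ler_pM ?mulr_ge0.
  have Fw'g : `|F * dotp w' g| <= 1 * (3 * lambda / 44).
    by rewrite normrM ler_pM // ler_norml; apply/andP; split; lra.
  have nl : lambda <= lambda * n by rewrite ler_pMr.
  rewrite DE (le_trans (ler_normD _ _)) //.
  have := ler_normD (b * (s`_0 + F) * a) (dotp (w' *m A) g); lra.
have := cross_term_le n0 l22 pb Db.
set k := 4 / n * p * _ => kb.
(* Splitting [g] along [v1] gives at most s_1 a^2 + s_2 (1 - a^2). *)
have QF : Q <= s`_1 + a ^+ 2 * lambda.
  rewrite /Q (qform_split g sA v1A v11) -/a lE.
  have gv : dotp (g - a *: v1) v1 = 0 by rewrite dotpBl dotpZl v11 mulr1 subrr.
  have := qform_le_nth1 sA sp v1A v11 gv.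
  rewrite dotpBl !dotpBr !dotpZl !dotpZr v11 g1 (dotpC v1) -/a; lra.
(* After multiplication by [n]: the form at [w] is at least s_1 b^2, that is s_1 n minus s_1
   |w'|^2. *)
have Fle : F <= - s`_0 + (3 * lambda / 44) ^+ 2.
  have qE := qform_split w sA v1A v11; have := pA (w - b *: v1).
  have w'E : dotp w' w' = n - b ^+ 2.
    by rewrite /w' dotpBl !dotpBr !dotpZl !dotpZr v11 (dotpC v1) -/b -/n; ring.
  have := dotp_ge0 w'; move: w'b; rewrite w'E.
  move: qE FE; rewrite -/b => -> FE nb b0 qw'.
  rewrite -(ler_pM2r n0) FE mulrDl.
  have s1n : s`_0 * (n - b ^+ 2) <= (3 * lambda / 44) ^+ 2 * n.
    apply: (le_trans _ (ler_peMr (sqr_ge0 _) n1)); apply: le_trans nb.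
    by rewrite ler_piMl.
  lra.
have -> : - 2 / n * (Q + F - k) = 2 * (- F - Q + k) / n by field; rewrite gt_eqF.
rewrite ltr_pdivlMr // ltr_pdivrMr //.
have a2 : a ^+ 2 <= (lambda / 44) ^+ 2.
  by rewrite -real_normK ?num_real // ler_sqr ?nnegrE.
have ll : lambda ^+ 2 <= lambda by rewrite expr2 ler_piMl // ltW.
have al : a ^+ 2 * lambda <= (lambda / 44) ^+ 2.
  by rewrite (le_trans _ a2) // ler_piMr // sqr_ge0.
have nl : lambda * n <= lambda * (1 + 1 / 484).
  by rewrite ler_wpM2l ?(ltW l0) //; lra.
(* The errors 9, 1 and 56, in units of lambda^2/1936, leave a bracket of at least 85 lambda/88;
   twice this exceeds lambda n. For the upper bound, the bracket is at most 1 + 7/242. *)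
move: kb; rewrite ler_norml => /andP[k1 k2].
apply/andP; split; last by lra.
lra.
Qed.


(** The value on the line of [v] is minus s_1. Splitting [x] along [v], the form is at most s_1
    times the squared norm on both components. *)
Lemma leading_eigenvector_minimizer A s v : A^T = A -> sorted_spectrum A s ->
  s`_1 <= s`_0 -> dotp v v = 1 -> v *m A = s`_0 *: v ->
  forall c, c != 0 -> global_minimizer (rayleigh_loss A) (c *: v).
Proof.
move=> sA sp s10 v1 vA c c0.
have v0 : v != 0 by rewrite -dotp_eq0 v1 oner_eq0.
split=> [|x x0]; first by rewrite scaler_eq0 negb_or c0.
have -> : rayleigh_loss A (c *: v) = - s`_0.
  rewrite /rayleigh_loss sqr_enorm qformZ /qform vA !(dotpZl, dotpZr) v1; field.
  by [].
rewrite /rayleigh_loss sqr_enorm ler_pdivlMr ?dotp_gt0 // mulNr lerN2.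
rewrite (qform_split x sA vA v1).
have xv : dotp (x - dotp x v *: v) v = 0 by rewrite dotpBl dotpZl v1 mulr1 subrr.
have := qform_le_nth1 sA sp vA v1 xv.
have := dotp_ge0 (x - dotp x v *: v).
have -> : dotp (x - dotp x v *: v) (x - dotp x v *: v) = dotp x x - dotp x v ^+ 2.
  by rewrite dotpBl !dotpBr !dotpZl !dotpZr v1 (dotpC v x); ring.
by move=> h0 h1; have := ler_wpM2r h0 s10; lra.
Qed.

Lemma rescaled_in_hyperplane_eball (r : R) v w0 : 0 <= r <= 1 ->
  dotp v v = 1 -> dotp w0 w0 = 1 -> dotp (w0 - v) (w0 - v) <= (r / 2) ^+ 2 ->
  dotp v w0 != 0 /\
  (hyperplane w0 `&` eball w0 r) ((dotp v w0)^-1 *: v).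
Proof.
move=> /andP[r0 r1] v1 w01; rewrite dotpBl !dotpBr v1 w01 (dotpC w0).
set c := dotp v w0 => cr.
have r2 : r ^+ 2 <= 1 by rewrite expr_le1.
(* The hypothesis reads 2 - 2c <= r^2/4, hence c >= 7/8. *)
have c_gt : 3 / 4 <= c by lra.
have c0 : c != 0 by rewrite gt_eqF //; lra.
split=> //; split; first by rewrite /hyperplane /= dotpZl mulVf.
rewrite /eball /= enorm_le // dotpBl !dotpBr !dotpZl !dotpZr v1 w01 (dotpC w0) -/c.
(* The squared distance is the squared tangent of the angle between [v] and [w0]. Since 1 - c^2 <=
   2(1 - c) <= r^2/4, the bound c^2 >= 9/16 suffices. *)
have -> : c^-1 * (c^-1 * 1) - c^-1 * c - (c^-1 * c - 1) = (1 - c ^+ 2) / c ^+ 2.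
  by field.
rewrite ler_pdivrMr ?exprn_gt0 //; last by lra.
have c2 : 9 / 16 <= c ^+ 2.
  have -> : 9 / 16 = (3 / 4) ^+ 2 :> R by field.
  by rewrite ler_sqr ?nnegrE; lra.
have := ler_wpM2l (sqr_ge0 r) c2.
have := sqr_ge0 (1 - c); have := sqr_ge0 r; lra.
Qed.

End Estimates.

(** * Convexity, Hessian bounds and the minimizer combined *)

Theorem theorem4 (R : realType) (d : nat) (hd : (1 < d)%N)
  (A : 'M[R]_d) (hA : psd_mx A) (hnorm : spectral_norm A = 1)
  (s : seq R) (hs : sorted_spectrum A s)
  (lambda : R) (hlambda : lambda = s`_0 - s`_1) (lambda_gt0 : 0 < lambda)
  (v1 : 'rV[R]_d) (hv1 : enorm v1 = 1) (hAv1 : v1 *m A = s`_0 *: v1)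
  (w0 : 'rV[R]_d) (hw0 : enorm w0 = 1)
  (hclose : enorm (w0 - v1) <= lambda / 44) :
  let C := hyperplane w0 `&` eball w0 (lambda / 22) in
  [/\ @convex_set R 'rV[R]_d C,
      smooth_on 20 w0 C (rayleigh_loss A),
      strongly_convex_on lambda w0 C (rayleigh_loss A) &
      exists2 w, C w & global_minimizer (rayleigh_loss A) w].
Proof.
move: hv1 hw0 => /enorm_eq1 v11 /enorm_eq1 w01.
have l22 : 0 <= lambda / 22 by lra.
move: hclose; rewrite enorm_le; last by lra.
move=> close C; have [sA _] := hA.
have bounds w g : C w -> enorm g = 1 -> dotp g w0 = 0 ->
    lambda < qform (hessian (rayleigh_loss A) w) g < 20.
  move=> [ww0]; rewrite /eball /= enorm_le // => wr /enorm_eq1 g1 gw0.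
  exact: (rayleigh_hessian_bounds hA hnorm hs hlambda lambda_gt0 v11 hAv1
    w01 close ww0 wr g1 gw0).
have twice w : C w -> twice_differentiable (rayleigh_loss A) w.
  move=> [ww0 _]; apply: twice_differentiable_rayleigh_loss => //.
  apply: contra_eq_neq ww0 => ->.
  by rewrite /dotp mul0mx mxE eq_sym oner_eq0.
split.
- exact: convex_hyperplane_eball.
- move=> w Cw; split; first exact: twice.
  by move=> g g1 gw0; have /andP[] := bounds w g Cw g1 gw0.
- move=> w Cw; split; first exact: twice.
  by move=> g g1 gw0; have /andP[] := bounds w g Cw g1 gw0.
- have s1le : s`_0 <= 1.
    have := qform_le1 v1 (fun y => spectral_norm1_contract y hnorm).
    by rewrite /qform hAv1 dotpZl v11 mulr1.
  have s2ge := nth1_spectrum_ge0 hA hs.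
  have r01 : 0 <= lambda / 22 <= 1 by apply/andP; split; lra.
  (* The allowed distance lambda/44 is half the radius, as the rescaling of [v1] onto the hyperplane
     requires. *)
  have close' : dotp (w0 - v1) (w0 - v1) <= (lambda / 22 / 2) ^+ 2.
    by rewrite (_ : lambda / 22 / 2 = lambda / 44) //; field.
  have [c0 Cv] := rescaled_in_hyperplane_eball r01 v11 w01 close'.
  exists ((dotp v1 w0)^-1 *: v1) => //.
  apply: (leading_eigenvector_minimizer sA hs) => //; last by rewrite invr_eq0.
  lra.
Qed.
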